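(* Let $\tau\ge0$ and $\lambda:=\tau/\varepsilon$ with $0\le\lambda\le1$. Define $H:\mathcal V_{[0,1]}\to\mathbb R$ by $$H(u):=\langle\mathbf 1-u,e^{-\tau\Delta}u\rangle_{\mathcal V}+(\lambda-1)\langle u,\mathbf 1-u\rangle_{\mathcal V}=\lambda\langle u,\mathbf 1-u\rangle_{\mathcal V}+\langle u,(I-e^{-\tau\Delta})u\rangle_{\mathcal V}.$$ Then $H$ is non-negative. Furthermore $H$ is a Lyapunov functional for the semi-discrete scheme: if $u_n\in\mathcal V_{[0,1]}$ and $u_{n+1}$ is defined from $u_n$ by the semi-discrete scheme, then $H(u_{n+1})\le H(u_n)$, with equality if and only if $u_{n+1}=u_n$. In particular, $$H(u_n)-H(u_{n+1})\ge(1-\lambda)\|u_{n+1}-u_n\|_{\mathcal V}^2.$$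
   Context: Let $G=(V,E)$ be a finite, undirected, simple, connected graph with symmetric weights $\omega_{ij}=\omega_{ji}$, $\omega_{ij}>0$ for $ij\in E$ and $\omega_{ij}=0$ for $ij\notin E$. Let $d_i=\sum_{j}\omega_{ij}>0$ be the degree of $i\in V$. Fix $r\in[0,1]$ and $\varepsilon>0$. Let $\mathcal V=\{u:V\to\mathbb R\}$ and, for $X\subseteq\mathbb R$, $\mathcal V_X=\{u:V\to X\}$; $\mathcal V$ carries the inner product $\langle u,v\rangle_{\mathcal V}=\sum_{i\in V}u_iv_id_i^r$ with norm $\|\cdot\|_{\mathcal V}$. $\mathbf 1\in\mathcal V$ is the constant function $1$. The graph Laplacian is $(\Delta u)_i=d_i^{-r}\sum_{j\in V}\omega_{ij}(u_i-u_j)$, and $e^{-t\Delta}=\sum_{n\ge0}\frac{(-1)^nt^n}{n!}\Delta^n$. For $u\in\mathcal V_{[0,1]}$, $\mathcal B(u)$ is the set of $\alpha\in\mathcal V$ such that for each $i\in V$: $\alpha_i\ge0$ if $u_i=0$, $\alpha_i=0$ if $0<u_i<1$, and $\alpha_i\le0$ if $u_i=1$. Semi-discrete scheme (time step $\tau$, $\lambda=\tau/\varepsilon$): given $u_n\in\mathcal V_{[0,1]}$, $u_{n+1}\in\mathcal V_{[0,1]}$ is such that for some $\beta_{n+1}\in\mathcal B(u_{n+1})$, $(1-\lambda)u_{n+1}-e^{-\tau\Delta}u_n+\frac\lambda2\mathbf 1=\lambda\beta_{n+1}$. *)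

(* Defs.v *)
From HB Require Import structures.
From mathcomp Require Import all_boot all_order all_algebra.
From mathcomp Require Import all_classical all_reals all_analysis.
Set Implicit Arguments.
Unset Strict Implicit.
Unset Printing Implicit Defensive.
Import Order.TTheory GRing.Theory Num.Theory.
Import numFieldNormedType.Exports.
Local Open Scope classical_set_scope.
Local Open Scope ring_scope.

Record weighted_graph (R : realType) (V : finType) := WeightedGraph {
  edge : rel V;
  weight : V -> V -> R;
  graph_nonempty : (0 < #|V|)%N;
  edge_irrefl : irreflexive edge;
  edge_sym : symmetric edge;
  edge_connected : forall i j : V, connect edge i j;
  weight_sym : forall i j : V, weight i j = weight j i;
  weight_gt0 : forall i j : V, edge i j -> 0 < weight i j;
  weight_eq0 : forall i j : V, ~~ edge i j -> weight i j = 0;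
  (* only excludes the one-vertex graph *)
  weight_sum_gt0 : forall i : V, 0 < \sum_(j : V) weight i j
}.

Section GraphCalculus.
Variables (R : realType) (V : finType) (G : weighted_graph R V) (r : R).
Implicit Types (u v alpha : V -> R) (i j : V).

Definition degree i : R := \sum_(j : V) weight G i j.

Definition valued_in (X : set R) : set (V -> R) := [set u | forall i, X (u i)].

Definition innerV u v : R := \sum_(i : V) u i * v i * degree i `^ r.

Definition normV u : R := Num.sqrt (innerV u u).

Definition laplacian u : V -> R :=
  fun i => degree i `^ (- r) * \sum_(j : V) weight G i j * (u i - u j).

(* e^{-t Delta} u, the sum of the exponential series taken at each vertex;
   as V is finite this is the same as summing the series of operators. *)
Definition heat (t : R) u : V -> R :=
  fun i => limn (series
    (fun n => (-1) ^+ n * t ^+ n / n`!%:R * iter n laplacian u i)).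

(* The set B(u); only meaningful for u with values in [0, 1]. *)
Definition subdiff u : set (V -> R) :=
  [set alpha | forall i, [/\ u i = 0 -> 0 <= alpha i,
                             0 < u i < 1 -> alpha i = 0 &
                             u i = 1 -> alpha i <= 0]].

(* One step u = u_n, v = u_{n+1} of the scheme, with lambda = tau / eps. *)
Definition semi_discrete_step (eps tau : R) u v : Prop :=
  let lambda := tau / eps in
  [/\ valued_in `[0, 1] u, valued_in `[0, 1] v &
      exists2 beta, subdiff v beta &
        (1 - lambda) *: v - heat tau u + (lambda / 2) *: cst 1
          = lambda *: beta].

Definition lyapunov (eps tau : R) u : R :=
  innerV (cst 1 - u) (heat tau u) + (tau / eps - 1) * innerV u (cst 1 - u).

End GraphCalculus.

(* Main.v *)
Require Import Defs.
From HB Require Import structures.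
From mathcomp Require Import all_boot all_order all_algebra.
From mathcomp Require Import all_classical all_reals all_analysis.
From mathcomp Require Import ring lra.
Set Implicit Arguments.
Unset Strict Implicit.
Unset Printing Implicit Defensive.
Import Order.TTheory GRing.Theory Num.Theory.
Import numFieldNormedType.Exports.
Local Open Scope classical_set_scope.
Local Open Scope ring_scope.

(** Write [E_t] for [e^{-t Delta}] and [lambda] for [tau / eps].  Differentiating
    the exponential series gives [d/dt E_t u = - Delta (E_t u)].  As [Delta] is
    self-adjoint, [s |-> <E_s a, E_(t - s) b>] has zero derivative, and comparing
    its values at different [s] yields ([innerV_heat_const]):
    - [E_t] is self-adjoint (values at [0] and [t]);
    - [<a, E_t a> = |E_(t/2) a|^2 >= 0] (values at [0] and [t/2]);
    - [E_(-s)] inverts [E_s] weakly (case [t = 0]), so the quadratic form of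
      [E_t] is definite ([innerV_heat_eq0]).
    Since the Dirichlet form [<u, Delta u>] is non-negative, [|E_s a|] decreases
    in [s], whence [<a, E_t a> <= <a, a>] for [t >= 0] ([innerV_heat_le]).  No
    diagonalization of [Delta] is involved.

    Self-adjointness and [E_t 1 = 1] give the second expression of [H], in which
    both terms are non-negative.  For a step from [u] to [v], with [w = v - u],
    expanding the quadratic functional [H] and using the scheme gives
      [H u - H v = (1 - lambda) |w|^2 + <w, E_tau w> - 2 lambda <w, beta>]
    ([lyapunov_decrease]).  The sign conditions on [beta] make the last term
    non-negative ([innerV_subdiff_le0]), which proves the quantitative bound.  In
    the equality case [<w, E_tau w> = 0], so [w = 0] by definiteness; this covers
    [lambda = 1], where the bound itself says nothing about [w]. *)

Section GraphHeat.
Variables (R : realType) (V : finType) (G : weighted_graph R V) (r : R).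
Implicit Types (u v w a b : V -> R) (i j : V) (s t : R).

Local Notation "<< u , v >>" := (innerV G r u v) (at level 0).
Local Notation Delta := (laplacian G r).
Local Notation E := (heat G r).

(** * The inner product *)

Lemma weight_ge0 i j : 0 <= weight G i j.
Proof.
by have [/weight_gt0/ltW //|/weight_eq0 ->] := boolP (edge G i j).
Qed.

Lemma degree_gt0 i : 0 < degree G i.
Proof. exact: weight_sum_gt0. Qed.

Lemma innerVC u v : <<u, v>> = <<v, u>>.
Proof. by apply: eq_bigr => i _; rewrite [u i * _]mulrC. Qed.

Lemma innerVDl u v w : <<u + v, w>> = <<u, w>> + <<v, w>>.
Proof. by rewrite -big_split; apply: eq_bigr => i _; rewrite !mulrDl. Qed.

Lemma innerVZl c u w : <<c *: u, w>> = c * <<u, w>>.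
Proof.
by rewrite mulr_sumr; apply: eq_bigr => i _; rewrite !fctE -!mulrA.
Qed.

Lemma innerVNl u w : <<- u, w>> = - <<u, w>>.
Proof. by rewrite -scaleN1r innerVZl mulN1r. Qed.

Lemma innerVBl u v w : <<u - v, w>> = <<u, w>> - <<v, w>>.
Proof. by rewrite innerVDl innerVNl. Qed.

Lemma innerVBr u v w : <<w, u - v>> = <<w, u>> - <<w, v>>.
Proof. by rewrite innerVC innerVBl ![<<_, w>>]innerVC. Qed.

Lemma innerV_ge0 u : 0 <= <<u, u>>.
Proof. by apply: sumr_ge0 => i _; rewrite mulr_ge0 ?powR_ge0// -expr2 sqr_ge0. Qed.

Lemma innerV_eq0 u : <<u, u>> = 0 -> u = 0.
Proof.
move=> u0; apply/funext => i.
have /psumr_eq0P : forall j, true -> 0 <= u j * u j * degree G j `^ r.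
  by move=> j _; rewrite mulr_ge0 ?powR_ge0// -expr2 sqr_ge0.
move=> /(_ u0 i isT)/eqP.
by rewrite !mulf_eq0 orbb (gt_eqF (powR_gt0 _ (degree_gt0 i))) orbF => /eqP.
Qed.

Lemma normV_sqr u : normV G r u ^+ 2 = <<u, u>>.
Proof. by rewrite sqr_sqrtr// innerV_ge0. Qed.

(** * The Laplacian *)

(** The degree factors of the inner product and of the Laplacian cancel; what
    remains is antisymmetrized by exchanging the two endpoints. *)
Lemma dirichlet_form u v :
  2 * <<u, Delta v>> =
  \sum_i \sum_j weight G i j * ((u i - u j) * (v i - v j)).
Proof.
have -> : <<u, Delta v>> = \sum_i \sum_j weight G i j * (u i * (v i - v j)).
  apply: eq_bigr => i _; rewrite /laplacian -mulrA [X in _ * X]mulrAC.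
  have -> : degree G i `^ (- r) * (degree G i `^ r) = 1.
    by rewrite powRN mulVf// gt_eqF// powR_gt0// degree_gt0.
  by rewrite mul1r mulr_sumr; apply: eq_bigr => j _; rewrite mulrCA.
rewrite mulr2n mulrDl mul1r {2}exchange_big -big_split.
apply: eq_bigr => i _; rewrite -big_split; apply: eq_bigr => j _ /=.
by rewrite [weight G j i]weight_sym; ring.
Qed.

Lemma laplacian_selfadjoint u v : <<u, Delta v>> = <<Delta u, v>>.
Proof.
apply: (@mulfI _ 2) => //; rewrite [<<Delta u, v>>]innerVC !dirichlet_form.
by apply: eq_bigr => i _; apply: eq_bigr => j _; rewrite [(u i - _) * _]mulrC.
Qed.

Lemma laplacian_ge0 u : 0 <= <<u, Delta u>>.
Proof.
rewrite -(@pmulr_rge0 _ 2)// dirichlet_form.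
apply: sumr_ge0 => i _; apply: sumr_ge0 => j _.
by rewrite mulr_ge0 ?weight_ge0// -expr2 sqr_ge0.
Qed.

Lemma laplacian1 : Delta (cst 1) = 0.
Proof.
apply/funext => i; rewrite /laplacian big1 ?mulr0// => j _.
by rewrite subrr mulr0.
Qed.

(** The Laplacian is bounded in sup norm; the geometric growth of its iterates
    makes the exponential series converge at every time. *)
Lemma iter_laplacian_bound u : exists K M : R,
  [/\ 0 <= K, 0 <= M & forall n i, `|iter n Delta u i| <= M * K ^+ n].
Proof.
pose K := \sum_i degree G i `^ (- r) * (degree G i * 2).
have K_ge0 : 0 <= K.
  apply: sumr_ge0 => i _.
  by rewrite mulr_ge0 ?powR_ge0// mulr_ge0// ltW// degree_gt0.
(* Sums over all vertices stand for maxima: they bound each of their terms. *)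
exists K, (\sum_i `|u i|); split => //; first exact: sumr_ge0.
elim=> [|n IH] i.
  by rewrite expr0 mulr1 /= (bigD1 i)//= lerDl sumr_ge0.
rewrite iterS exprS mulrCA; set B := _ * K ^+ n in IH *.
have B_ge0 : 0 <= B := le_trans (normr_ge0 _) (IH i).
rewrite /laplacian normrM ger0_norm ?powR_ge0//.
apply: (@le_trans _ _ (degree G i `^ (- r) * (degree G i * 2) * B)).
  rewrite -mulrA ler_wpM2l ?powR_ge0//.
  rewrite (le_trans (ler_norm_sum _ _ _))// /degree -mulrA mulr_suml ler_sum// => j _.
  rewrite normrM ger0_norm ?weight_ge0// ler_wpM2l ?weight_ge0//.
  by rewrite mulrDl mul1r (le_trans (ler_normB _ _))// lerD.
rewrite ler_wpM2r// /K (bigD1 i)//= lerDl sumr_ge0// => j _.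
by rewrite mulr_ge0 ?powR_ge0// mulr_ge0// ltW// degree_gt0.
Qed.

(** * The heat flow *)

Definition heat_coef u i (n : nat) : R :=
  (-1) ^+ n / n`!%:R * iter n Delta u i.

Lemma heat_pseries t u i : E t u i = limn (pseries (heat_coef u i) t).
Proof.
rewrite /heat /pseries /heat_coef; congr (limn (series _)).
by apply/funext => n /=; ring.
Qed.

(** This is [d/dt e^{-t Delta} = - e^{-t Delta} Delta] at the level of
    coefficients; the Laplacian is applied inside the series, and
    [laplacian_heat] moves it outside. *)
Lemma heat_coef_diffs u i :
  pseries_diffs (heat_coef u i) = - heat_coef (Delta u) i.
Proof.
apply/funext => n; rewrite /pseries_diffs /heat_coef iterSr fctE /=.
rewrite factS natrM exprS.
field.
by rewrite pnatr_eq0 -lt0n fact_gt0/= nat1r pnatr_eq0.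
Qed.

Lemma cvg_heat_coef u i t : cvgn (pseries (heat_coef u i) t).
Proof.
have [K [M [K_ge0 M_ge0 uKM]]] := iter_laplacian_bound u.
apply/normed_cvg; apply: (@series_le_cvg _ _ (M *: exp_coeff (K * `|t|))).
- by move=> n /=.
- by move=> n; rewrite fctE mulr_ge0// exp_coeff_ge0// mulr_ge0.
- move=> n /=; rewrite fctE /exp_coeff /= /heat_coef !normrM normrX normrN1 expr1n.
  rewrite mul1r [`|_^-1|]ger0_norm ?invr_ge0// normrX exprMn /GRing.scale /=.
  rewrite [leRHS](_ : _ = n`!%:R^-1 * (M * K ^+ n) * `|t| ^+ n); last by ring.
  by rewrite ler_wpM2r ?exprn_ge0// ler_wpM2l ?invr_ge0.
- exact/is_cvg_seriesZ/is_cvg_series_exp_coeff.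
Qed.

Lemma heat0 u : E 0 u = u.
Proof.
apply/funext => i; rewrite heat_pseries; apply: cvg_lim => //.
rewrite -cvg_shiftS /=; apply: cvg_near_cst; near=> n.
rewrite /pseries /series /= big_nat_recl//= big1 => [|k _]; last first.
  by rewrite expr0n mulr0.
by rewrite /heat_coef fact0 /= !expr0 divr1 mul1r mulr1 addr0.
Unshelve. all: by end_near. Qed.

(** The Laplacian has finite range, so it can be applied to the exponential
    series term by term. *)
Lemma laplacian_heat t u : Delta (E t u) = E t (Delta u).
Proof.
apply/funext => i; rewrite [RHS]heat_pseries; apply/esym/cvg_lim => //.
have cE j : pseries (heat_coef u j) t @ \oo --> E t u j.
  by rewrite heat_pseries; exact: cvg_heat_coef.
have -> : pseries (heat_coef (Delta u) i) t =
    (fun n => Delta (fun j => pseries (heat_coef u j) t n) i).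
  apply/funext => n; rewrite /laplacian /pseries /series /=.
  under [in RHS]eq_bigr do rewrite -sumrB mulr_sumr.
  rewrite exchange_big mulr_sumr; apply: eq_bigr => k _.
  rewrite /heat_coef -iterSr /= /laplacian !mulr_sumr mulr_suml.
  by apply: eq_bigr => j _; ring.
apply: cvgM; first exact: cvg_cst.
apply: cvg_big => [|j _]; first exact: add_continuous.
apply: cvgM; first exact: cvg_cst.
by apply: cvgB; exact: cE.
Qed.

Lemma heat1 t : E t (cst 1) = cst 1.
Proof.
apply/funext => i; rewrite -[RHS](congr1 (@^~ i) (heat0 (cst 1))).
rewrite !heat_pseries; congr (limn (series _)); apply/funext => -[|n] //=.
have -> : heat_coef (cst 1) i n.+1 = 0; last by rewrite !mul0r.
rewrite /heat_coef iterSr laplacian1.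
have -> : iter n Delta 0 = 0 by elim: n => //= n ->; apply/funext => j;
  rewrite /laplacian big1 ?mulr0// => k _; rewrite subrr mulr0.
by rewrite mulr0.
Qed.

Lemma is_derive_heat t u i :
  is_derive t 1 (fun s => E s u i) (- Delta (E t u) i).
Proof.
rewrite laplacian_heat heat_pseries.
under eq_fun do rewrite heat_pseries.
rewrite -limN; last exact: cvg_heat_coef.
(* Any radius larger than [`|t|] will do: the series converges everywhere. *)
have := @pseries_snd_diffs R (heat_coef u i) (`|t| + 1) t.
rewrite !(heat_coef_diffs, pseries_diffsN) opprK.
have pN f x : pseries (- f) x = - pseries f x :> (nat -> R).
  by rewrite /pseries -seriesN; congr series; apply/funext => n; exact: mulNr.
rewrite !pN.
apply; [exact: cvg_heat_coef|by rewrite is_cvgNE; exact: cvg_heat_coef|exact: cvg_heat_coef|].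
by rewrite [ltRHS]ger0_norm ?addr_ge0// ltrDl.
Qed.

Lemma is_derive_innerV (f g : R -> V -> R) (df dg : V -> R) t :
  (forall i, is_derive t 1 (f^~ i) (df i)) ->
  (forall i, is_derive t 1 (g^~ i) (dg i)) ->
  is_derive t 1 (fun s => <<f s, g s>>) (<<df, g t>> + <<f t, dg>>).
Proof.
move=> hf hg; rewrite -big_split /=.
rewrite [X in is_derive _ _ X](_ : _ =
    \sum_i (fun s => f s i * g s i * degree G i `^ r)); last first.
  by apply/funext => s; rewrite fct_sumE.
elim/big_ind2: _ => [|x1 x2 y1 y2 h1 h2|i _]; [exact: is_derive_cst|exact: is_deriveD|].
have h := is_deriveM (is_deriveM (hf i) (hg i)) (is_derive_cst (degree G i `^ r) t 1).
apply: is_derive_eq h _.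
by rewrite /GRing.scale /=; ring.
Qed.

(** Along the flow [s |-> <e^{-s Delta} a, e^{-(t - s) Delta} b>] the two
    derivatives cancel, because the Laplacian is self-adjoint. *)
Lemma innerV_heat_const t a b s1 s2 :
  <<E s1 a, E (t - s1) b>> = <<E s2 a, E (t - s2) b>>.
Proof.
apply: (is_derive_0_is_cst (f := fun s => <<E s a, E (t - s) b>>)) => s.
have dB i : is_derive s 1 (fun s => E (t - s) b i) (Delta (E (t - s) b) i).
  have dsub : is_derive s 1 (fun s => t - s) (0 - 1).
    exact: (is_deriveB (is_derive_cst t s 1) (is_derive_id s 1)).
  have h := @is_derive1_comp _ (fun s => E s b i) (fun s => t - s) s _ _
    (is_derive_heat (t - s) b i) dsub.
  by apply: is_derive_eq h _; rewrite sub0r mulrN1 opprK.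
have h := is_derive_innerV (fun i => is_derive_heat s a i) dB.
apply: is_derive_eq h _.
by rewrite laplacian_selfadjoint (innerVNl (Delta (E s a))) addNr.
Qed.

Lemma heat_selfadjoint t a b : <<E t a, b>> = <<a, E t b>>.
Proof.
by have := innerV_heat_const t a b t 0; rewrite subrr subr0 !heat0.
Qed.

Lemma innerV_heat_half t a : <<a, E t a>> = <<E (t / 2) a, E (t / 2) a>>.
Proof.
have := innerV_heat_const t a a 0 (t / 2); rewrite subr0 heat0.
by congr (_ = << _, E _ _ >>); field.
Qed.

(** The flow run backwards inverts the flow, so [e^{-(t/2) Delta} a] vanishes
    only when [a] does. *)
Lemma innerV_heat_eq0 t a : <<a, E t a>> = 0 -> a = 0.
Proof.
rewrite innerV_heat_half => /innerV_eq0 a0; apply: innerV_eq0.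
have := innerV_heat_const 0 a a 0 (t / 2); rewrite subr0 !heat0 a0 => ->.
by rewrite /innerV big1// => i _; rewrite !mul0r.
Qed.

Lemma innerV_heat_ge0 t a : 0 <= <<a, E t a>>.
Proof. by rewrite innerV_heat_half innerV_ge0. Qed.

(** The squared norm decreases along the flow, at the rate given by twice the
    Dirichlet form. *)
Lemma innerV_heat_le t a : 0 <= t -> <<a, E t a>> <= <<a, a>>.
Proof.
move=> t_ge0; rewrite innerV_heat_half -[X in _ <= <<X, X>>]heat0.
pose f s := <<E s a, E s a>>.
have df s : is_derive s 1 f (- (2 * <<E s a, Delta (E s a)>>)).
  have h := is_derive_innerV (fun i => is_derive_heat s a i)
    (fun i => is_derive_heat s a i).
  apply: is_derive_eq h _.
  by rewrite [<<E s a, _>>]innerVC (innerVNl (Delta (E s a))) innerVC; ring.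
have fdrv s : derivable f s 1 by have [] := df s.
apply: (@ler0_derive1_le_cc _ f 0 (t / 2)) => //; rewrite ?in_itv/= ?lexx ?divr_ge0//.
- move=> s _; rewrite derive1E; have [_ ->] := df s.
  by rewrite oppr_le0 mulr_ge0// laplacian_ge0.
- by apply: derivable_within_continuous.
Qed.

(** * The Lyapunov functional *)

Lemma lyapunovE eps tau u : lyapunov G r eps tau u =
  tau / eps * <<u, cst 1 - u>> + <<u, u - E tau u>>.
Proof.
rewrite /lyapunov innerVBl -[<<cst 1, E tau u>>]heat_selfadjoint heat1.
by rewrite [<<u, u - _>>]innerVBr !innerVBr [<<cst 1, u>>]innerVC; ring.
Qed.

Lemma lyapunov_ge0 eps tau u : 0 <= tau -> 0 <= tau / eps ->
  valued_in `[0, 1] u -> 0 <= lyapunov G r eps tau u.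
Proof.
move=> tau_ge0 lam_ge0 u01; rewrite lyapunovE addr_ge0//.
  rewrite mulr_ge0//; apply: sumr_ge0 => i _; rewrite mulr_ge0 ?powR_ge0//.
  have := u01 i; rewrite /= in_itv/= => /andP[u0 u1].
  by rewrite mulr_ge0// fctE subr_ge0.
by rewrite innerVBr subr_ge0 innerV_heat_le.
Qed.

(** The sign conditions of the subdifferential say that it points into the
    unit interval, where [u] lies. *)
Lemma innerV_subdiff_le0 u v beta :
  valued_in `[0, 1] u -> valued_in `[0, 1] v -> subdiff v beta ->
  <<v - u, beta>> <= 0.
Proof.
move=> u01 v01 vb; apply: sumr_le0 => i _; rewrite mulr_le0_ge0 ?powR_ge0//.
have := u01 i; have := v01 i; rewrite /= !in_itv/= fctE => /andP[v0 v1] /andP[u0 u1].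
have [b0 bI b1] := vb i.
have [vi0|vi0] := eqVneq (v i) 0.
  by rewrite mulr_le0_ge0 ?b0// vi0 sub0r oppr_le0.
have [vi1|vi1] := eqVneq (v i) 1.
  by rewrite mulr_ge0_le0 ?b1// vi1 subr_ge0.
by rewrite bI ?mulr0// !lt_neqAle eq_sym vi0 v0 vi1 v1.
Qed.

(** [lyapunov] is quadratic, so its decrease along a step is its differential
    plus a second-order term; the scheme, paired with [v - u], expresses the
    differential through [|v - u|^2] and [<v - u, beta>]. *)
Lemma lyapunov_decrease eps tau u v beta :
  (1 - tau / eps) *: v - E tau u + (tau / eps / 2) *: cst 1
    = (tau / eps) *: beta ->
  lyapunov G r eps tau u - lyapunov G r eps tau v =
  (1 - tau / eps) * <<v - u, v - u>> + <<v - u, E tau (v - u)>>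
  - 2 * (tau / eps) * <<v - u, beta>>.
Proof.
set lam := tau / eps => step.
have : (1 - lam) * <<v, v - u>> - <<E tau u, v - u>>
    + lam / 2 * <<cst 1, v - u>> = lam * <<v - u, beta>>.
  by rewrite [<<v - u, beta>>]innerVC -!innerVZl -innerVBl -innerVDl step.
rewrite !lyapunovE -/lam -[<<v - u, E tau _>>]heat_selfadjoint.
rewrite !(innerVBl, innerVBr).
rewrite [<<E tau (v - u), u>>]heat_selfadjoint [<<E tau (v - u), v>>]heat_selfadjoint.
rewrite !(innerVBl, innerVBr) ![<<E tau _, _>>]innerVC [<<cst 1, _>>]innerVC.
rewrite [<<cst 1, u>>]innerVC.
rewrite [<<u, v>>]innerVC [<<u, E tau v>>]innerVC heat_selfadjoint.
lra.
Qed.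

End GraphHeat.

(** * Decrease along the scheme *)

Theorem theorem4p5 (R : realType) (V : finType) (G : weighted_graph R V)
    (r eps tau lambda : R)
    (hr : 0 <= r <= 1) (heps : 0 < eps) (htau : 0 <= tau)
    (hlambda : lambda = tau / eps) (hlambda01 : 0 <= lambda <= 1) :
  [/\ forall u : V -> R, valued_in `[0, 1] u ->
        lyapunov G r eps tau u
          = lambda * innerV G r u (cst 1 - u)
            + innerV G r u (u - heat G r tau u),
      forall u : V -> R, valued_in `[0, 1] u -> 0 <= lyapunov G r eps tau u &
      forall u v : V -> R, semi_discrete_step G r eps tau u v ->
        [/\ lyapunov G r eps tau v <= lyapunov G r eps tau u,
            lyapunov G r eps tau v = lyapunov G r eps tau u <-> v = u &
            (1 - lambda) * normV G r (v - u) ^+ 2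
              <= lyapunov G r eps tau u - lyapunov G r eps tau v]].
Proof.
move: hlambda01 => /andP[lam0 lam1]; subst lambda.
split=> [u _|u u01|u v [u01 v01 [beta vb step]]].
- exact: lyapunovE.
- exact: lyapunov_ge0.
have dec := lyapunov_decrease step.
have bw : 0 <= - (2 * (tau / eps) * innerV G r (v - u) beta).
  rewrite oppr_ge0 mulr_ge0_le0 ?(mulr_ge0 _ lam0)//.
  exact: innerV_subdiff_le0 u01 v01 vb.
have Ew : 0 <= innerV G r (v - u) (heat G r tau (v - u)) := innerV_heat_ge0 _ _ _ _.
have ww : 0 <= (1 - tau / eps) * innerV G r (v - u) (v - u).
  by rewrite mulr_ge0 ?subr_ge0// innerV_ge0.
split; [lra| |by rewrite normV_sqr; lra].
split=> [Huv|->//]; apply/subr0_eq/(@innerV_heat_eq0 _ _ G r tau).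
lra.
Qed.
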